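(* Let $\mathbb{T}$ be a time scale, let $a,b\in\mathbb{T}$ with $a<b$, and let $I_{\mathbb{T}}=[a,b]\cap\mathbb{T}$. Let $f\in C_{rd}(I_{\mathbb{T}},\mathbb{R})$, and let $k\in C_{rd}(I_{\mathbb{T}}\times I_{\mathbb{T}}\times\mathbb{R},\mathbb{R})$ be non-decreasing in its third argument. Let $v,w\in C_{rd}(I_{\mathbb{T}},\mathbb{R})$ be, respectively, a lower and an upper solution of the integral equation $$x(t)=f(t)+\int_a^t k(t,s,x(s))\,\Delta s,\qquad t\in I_{\mathbb{T}},$$ that is, for all $t\in I_{\mathbb{T}}$, $$v(t)\le f(t)+\int_a^t k(t,s,v(s))\,\Delta s\quad\text{and}\quad w(t)\ge f(t)+\int_a^t k(t,s,w(s))\,\Delta s ,$$ and suppose $v(t)\le w(t)$ for all $t\in I_{\mathbb{T}}$. Define sequences by $v_0=v$, $w_0=w$ and, for $n\ge 1$ and $t\in I_{\mathbb{T}}$, $$v_n(t)=f(t)+\int_a^t k(t,s,v_{n-1}(s))\,\Delta s,\qquad w_n(t)=f(t)+\int_a^t k(t,s,w_{n-1}(s))\,\Delta s .$$ Then $(v_n)$ and $(w_n)$ converge uniformly on $I_{\mathbb{T}}$ and monotonically to the minimal solution $\beta$ and the maximal solution $\alpha$ of the integral equation, respectively.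
   Context: A time scale $\mathbb{T}$ is a nonempty closed subset of $\mathbb{R}$. The jump operators are $\sigma(t)=\inf\{s\in\mathbb{T}:s>t\}$ and $\rho(t)=\sup\{s\in\mathbb{T}:s<t\}$. A point $t\in I_{\mathbb{T}}$ is right-dense if $t<b$ and $\sigma(t)=t$, and left-dense if $t>a$ and $\rho(t)=t$. A function $g:I_{\mathbb{T}}\to\mathbb{R}$ is rd-continuous, written $g\in C_{rd}(I_{\mathbb{T}},\mathbb{R})$, if it is continuous at every right-dense point and has a finite left-sided limit at every left-dense point. Rd-continuity of a function $k$ on $I_{\mathbb{T}}\times I_{\mathbb{T}}\times\mathbb{R}$ is understood as follows. For $\tau\in I_{\mathbb{T}}$ let $\mathcal{A}_\tau=\{I_{\mathbb{T}}\}$ if $\tau$ is right-dense. Otherwise let $\mathcal{A}_\tau$ consist of $\{\tau\}$ and, if $\tau$ is left-dense, also of $\{t\in I_{\mathbb{T}}:t<\tau\}$. Then $k\in C_{rd}(I_{\mathbb{T}}\times I_{\mathbb{T}}\times\mathbb{R},\mathbb{R})$ if for all $(t_0,s_0,p_0)$ and all $A\in\mathcal{A}_{t_0}$, $B\in\mathcal{A}_{s_0}$, the limit of $k(t,s,p)$ as $(t,s,p)\to(t_0,s_0,p_0)$ within $A\times B\times\mathbb{R}$ exists and is finite, and it equals $k(t_0,s_0,p_0)$ whenever $t_0\in A$ and $s_0\in B$. The delta derivative $F^\Delta(t)$ is the number such that for every $\varepsilon>0$ there is a neighborhood $U$ of $t$ with $|F(\sigma(t))-F(s)-F^\Delta(t)(\sigma(t)-s)|\le\varepsilon|\sigma(t)-s|$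 for all $s\in U$. The delta integral is $\int_r^s g(t)\,\Delta t=F(s)-F(r)$, where $F$ is an antiderivative of $g$, i.e. $F^\Delta=g$ (at all points except a left-scattered maximum). Every rd-continuous function has an antiderivative. Sector: $[v,w]=\{z\in C_{rd}(I_{\mathbb{T}},\mathbb{R}): v(t)\le z(t)\le w(t)\text{ for all }t\in I_{\mathbb{T}}\}$. Solutions $\alpha,\beta\in C_{rd}(I_{\mathbb{T}},\mathbb{R})$ of the integral equation are called the maximal and minimal solutions, respectively, if every solution $x\in[v,w]$ satisfies $\beta(t)\le x(t)\le\alpha(t)$ for all $t\in I_{\mathbb{T}}$.
   Formalization: The antiderivative F in the delta integral must satisfy F^Δ=g at all points t<b and be continuous at b; requiring F^Δ(b)=g(b) at a left-dense b would leave some rd-continuous g without antiderivative (e.g. the indicator of {1} on [0,1]). Where both integrals exist they agree. *)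

(* Defs.v *)
From HB Require Import structures.
From mathcomp Require Import all_boot all_order all_algebra.
From mathcomp Require Import all_classical all_reals all_analysis.

Set Implicit Arguments.
Unset Strict Implicit.
Unset Printing Implicit Defensive.

Import Order.TTheory GRing.Theory Num.Theory.
Import numFieldNormedType.Exports.

Local Open Scope classical_set_scope.
Local Open Scope ring_scope.

(* Functions on the time scale interval I_T are represented by total functions
   on R; every notion below depends only on their values on I_T. *)

Definition time_scale (R : realType) (T : set R) : Prop :=
  T !=set0 /\ closed T.

(* [inf] and [sup] of the empty set are 0 in the library, so [sigma] and [rho]
   are meaningful only below a maximum, resp. above a minimum, of T. They are
   only used at t < b and at t > a, respectively. *)
Definition sigma (R : realType) (T : set R) (t : R) : R :=
  inf [set s | T s /\ t < s].

Definition rho (R : realType) (T : set R) (t : R) : R :=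
  sup [set s | T s /\ s < t].

Definition tsI (R : realType) (T : set R) (a b : R) : set R :=
  T `&` [set t | a <= t <= b].

Definition right_dense (R : realType) (T : set R) (a b t : R) : Prop :=
  [/\ tsI T a b t, t < b & sigma T t = t].

Definition left_dense (R : realType) (T : set R) (a b t : R) : Prop :=
  [/\ tsI T a b t, a < t & rho T t = t].

Definition rd_continuous (R : realType) (T : set R) (a b : R) (g : R -> R) :
    Prop :=
  (forall t, right_dense T a b t ->
     g @ within (tsI T a b) (nbhs t) --> g t) /\
  (forall t, left_dense T a b t ->
     exists l : R, g @ within (tsI T a b `&` [set s | s < t]) (nbhs t) --> l).

(* The family of sets A_tau along which limits at tau are taken. *)
Definition rd_sides (R : realType) (T : set R) (a b tau : R) : set (set R) :=
  [set A |
    (right_dense T a b tau /\ A = tsI T a b) \/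
    (~ right_dense T a b tau /\
      (A = [set tau] \/
       (left_dense T a b tau /\ A = tsI T a b `&` [set t | t < tau])))].

Definition rd_continuous3 (R : realType) (T : set R) (a b : R)
    (k : R -> R -> R -> R) : Prop :=
  forall t0 s0 p0 : R, tsI T a b t0 -> tsI T a b s0 ->
  forall A B : set R, rd_sides T a b t0 A -> rd_sides T a b s0 B ->
  exists l : R,
    (fun z : R * R * R => k z.1.1 z.1.2 z.2) @
      within [set z : R * R * R | A z.1.1 /\ B z.1.2] (nbhs (t0, s0, p0))
      --> l /\
    (A t0 -> B s0 -> l = k t0 s0 p0).

(* F^Delta(t) = d, for a point t < b of I_T (so that sigma(t) lies in I_T). *)
Definition is_delta_derive (R : realType) (T : set R) (a b : R)
    (F : R -> R) (t d : R) : Prop :=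
  forall e : R, 0 < e ->
    \forall s \near within (tsI T a b) (nbhs t),
      `|F (sigma T t) - F s - d * (sigma T t - s)| <= e * `|sigma T t - s|.

(* At a left-dense right end point b, only continuity of F is required instead
   of F^Delta(b) = g(b). An rd-continuous g may jump at such a b (b is not
   right-dense); F^Delta(b) is then necessarily the left limit of g, and the
   equation at b would leave g without antiderivative. Whenever F^Delta(b) =
   g(b) does hold, F is continuous at b, so the two definitions give the same
   integral. If b is left-scattered the second clause is vacuous. *)
Definition is_antiderivative (R : realType) (T : set R) (a b : R)
    (g F : R -> R) : Prop :=
  (forall t, tsI T a b t -> t < b -> is_delta_derive T a b F t (g t)) /\
  F @ within (tsI T a b) (nbhs b) --> F b.

(* For r, s in I_T the value does not depend on the chosen antiderivative; if
   there is none (which does not happen for rd-continuous g) it is 0. *)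
Definition delta_integral (R : realType) (T : set R) (a b : R)
    (g : R -> R) (r s : R) : R :=
  let F := xget (cst 0) [set F : R -> R | is_antiderivative T a b g F] in
  F s - F r.

Definition volterra (R : realType) (T : set R) (a b : R) (f : R -> R)
    (k : R -> R -> R -> R) (x : R -> R) : R -> R :=
  fun t => f t + delta_integral T a b (fun s => k t s (x s)) a t.

Definition solution (R : realType) (T : set R) (a b : R) (f : R -> R)
    (k : R -> R -> R -> R) (x : R -> R) : Prop :=
  rd_continuous T a b x /\
  forall t, tsI T a b t -> x t = volterra T a b f k x t.

Definition lower_solution (R : realType) (T : set R) (a b : R) (f : R -> R)
    (k : R -> R -> R -> R) (v : R -> R) : Prop :=
  rd_continuous T a b v /\
  forall t, tsI T a b t -> v t <= volterra T a b f k v t.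

Definition upper_solution (R : realType) (T : set R) (a b : R) (f : R -> R)
    (k : R -> R -> R -> R) (w : R -> R) : Prop :=
  rd_continuous T a b w /\
  forall t, tsI T a b t -> volterra T a b f k w t <= w t.

Definition sector (R : realType) (T : set R) (a b : R) (v w : R -> R) :
    set (R -> R) :=
  [set z | rd_continuous T a b z /\
           forall t, tsI T a b t -> v t <= z t <= w t].

Definition minimal_maximal_solutions (R : realType) (T : set R) (a b : R)
    (f : R -> R) (k : R -> R -> R -> R) (v w beta alpha : R -> R) : Prop :=
  [/\ solution T a b f k beta, solution T a b f k alpha &
      forall x, solution T a b f k x -> sector T a b v w x ->
        forall t, tsI T a b t -> beta t <= x t <= alpha t].

Definition iterates (R : realType) (T : set R) (a b : R) (f : R -> R)
    (k : R -> R -> R -> R) (x0 : R -> R) : nat -> R -> R :=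
  fun n => iter n (volterra T a b f k) x0.

(* Main.v *)
Require Import Defs.
From HB Require Import structures.
From mathcomp Require Import all_boot all_order all_algebra.
From mathcomp Require Import all_classical all_reals all_analysis.
From mathcomp Require Import ring lra.

Import Order.TTheory GRing.Theory Num.Theory.
Import numFieldNormedType.Exports.

Local Open Scope classical_set_scope.
Local Open Scope ring_scope.

(** Since the kernel is monotone, so is the Volterra operator, and the iterates of
    [v] and [w] increase and decrease between [v] and [w]; hence they converge
    pointwise. Compactness of the time scale interval makes the kernel uniformly
    continuous in its third argument and uniformly Cauchy along each one-sided
    neighbourhood in its first, so the iterates are equicontinuous there and
    converge uniformly, the limits solving the equation. The integral enters only
    through monotonicity and Lipschitz bounds, which follow from a mean value
    inequality for antiderivatives; antiderivatives of rd-continuous functions are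
    upper Darboux integrals. *)

(** * Limits within a set in epsilon-delta form *)

Lemma near_within_distP (R : realType) (A : set R) (t : R) (P : R -> Prop) :
  (\forall s \near within A (nbhs t), P s) <->
  exists2 d : R, 0 < d & forall s, A s -> `|s - t| < d -> P s.
Proof.
rewrite near_withinE; split.
  move=> /nbhs_ballP[d /= d0 h]; exists d => // s As sd; apply: h => //.
  by rewrite /ball /= distrC.
move=> [d d0 h]; apply/nbhs_ballP; exists d => //= s.
by rewrite /ball /= distrC => sd As; exact: h.
Qed.

Lemma cvg_within_distP (R : realType) (A : set R) (t l : R) (g : R -> R) :
  g @ within A (nbhs t) --> l <->
  forall e : R, 0 < e ->
    exists2 d : R, 0 < d & forall s, A s -> `|s - t| < d -> `|g s - l| <= e.
Proof.
split.
  move=> /cvgrPdist_le h e e0; apply/near_within_distP.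
  by apply: filterS (h e e0) => s; rewrite distrC.
move=> h; apply/cvgrPdist_le => e e0.
have /near_within_distP := h e e0.
by apply: filterS => s; rewrite distrC.
Qed.

(** * Jump operators and compactness of the time scale interval *)

Section TimeScale.
Variables (R : realType) (T : set R) (a b : R).
Hypotheses (hT : time_scale T) (ha : T a) (hb : T b) (hab : a < b).
Local Notation I := (tsI T a b).

Lemma tsI_bounds t : I t -> a <= t <= b.
Proof. by case. Qed.

Lemma tsI_left : I a.
Proof. by split=> //=; rewrite lexx ltW. Qed.

Lemma tsI_right : I b.
Proof. by split=> //=; rewrite lexx ltW. Qed.

Lemma tsI_compact : compact I.
Proof.
apply: (@subclosed_compact _ _ `[a, b]); last 2 first.
- exact: segment_compact.
- by move=> t [_ /=]; rewrite in_itv.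
apply: closedI; first by case: hT.
have -> : [set t | a <= t <= b] = `[a, b]%classic.
  by apply/seteqP; split=> t /=; rewrite in_itv.
exact: itv_closed.
Qed.

Lemma tsI_closed t : (forall d, 0 < d -> exists2 s, I s & `|s - t| < d) -> I t.
Proof.
move=> h; have cI : closed I by apply: compact_closed (tsI_compact); exact: norm_hausdorff.
apply: cI => B /nbhs_ballP[d /= d0 dB].
have [s Is sd] := h d d0; exists s; split=> //; apply: dB.
by rewrite /ball /= distrC.
Qed.

Lemma sigma_le t s : I t -> T s -> t < s -> sigma T t <= s.
Proof.
move=> It Ts ts; apply: ge_inf; last by split.
by exists t => u [_ /ltW].
Qed.

Lemma sigma_ge t : I t -> t < b -> t <= sigma T t.
Proof.
move=> It tb; apply: lb_le_inf; first by exists b.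
by move=> u [_ /ltW].
Qed.

Lemma sigma_approx t d : I t -> t < b -> 0 < d ->
  exists s, [/\ I s, t < s & s < sigma T t + d].
Proof.
move=> It tb d0.
have [||s [Ts ts] sd] := @inf_lt _ [set s | T s /\ t < s] (sigma T t + d).
- by exists b.
- by rewrite ltrDl.
have [sb|bs] := leP s b.
  exists s; split=> //; split=> //=; rewrite sb andbT ltW// (le_lt_trans _ ts)//.
  by case/andP: (tsI_bounds _ It).
by exists b; split=> //; [exact: tsI_right|exact: lt_trans sd].
Qed.

Lemma tsI_sigma t : I t -> t < b -> I (sigma T t).
Proof.
move=> It tb; apply: tsI_closed => d d0.
have [s [Is ts sd]] := sigma_approx _ _ It tb d0.
exists s => //; have := sigma_le _ _ It Is.1 ts => ss.
by rewrite ger0_norm ?subr_ge0// ltrBlDl.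
Qed.

Lemma rho_ge t s : I t -> T s -> s < t -> s <= rho T t.
Proof.
move=> It Ts ts; apply: ub_le_sup; last by split.
by exists t => u [_ /ltW].
Qed.

Lemma rho_le t : I t -> a < t -> rho T t <= t.
Proof.
move=> It tb; apply: ge_sup; first by exists a.
by move=> u [_ /ltW].
Qed.

Lemma gap_right t : I t -> ~ right_dense T a b t ->
  exists2 d : R, 0 < d & forall s, I s -> `|s - t| < d -> s <= t.
Proof.
move=> It nd; have [tb|bt] := ltP t b; last first.
  by exists 1 => // s /tsI_bounds/andP[_ sb] _; apply: le_trans bt.
have ts : t < sigma T t.
  rewrite lt_neqAle sigma_ge// andbT; apply/eqP => ts.
  by apply: nd; split.
exists (sigma T t - t) => [|s Is]; first by rewrite subr_gt0.
case: (leP s t) => // lts; rewrite gtr0_norm ?subr_gt0// ltrD2r ltNge.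
by rewrite (sigma_le _ _ It Is.1).
Qed.

Lemma gap_left t : I t -> ~ left_dense T a b t ->
  exists2 d : R, 0 < d & forall s, I s -> `|s - t| < d -> t <= s.
Proof.
move=> It nd; have [tb|bt] := ltP a t; last first.
  by exists 1 => // s /tsI_bounds/andP[sb _] _; apply: le_trans sb.
have ts : rho T t < t.
  rewrite lt_neqAle rho_le// andbT; apply/eqP => ts.
  by apply: nd; split.
exists (t - rho T t) => [|s Is]; first by rewrite subr_gt0.
case: (leP t s) => // lts; rewrite distrC gtr0_norm ?subr_gt0// ltrD2l ltrN2.
by rewrite ltNge (rho_ge _ _ It Is.1).
Qed.

(** * One-sided neighbourhoods and gluing by compactness *)

Lemma rd_side_singleton t : ~ right_dense T a b t -> rd_sides T a b t [set t].
Proof. by move=> nd; right; split=> //; left. Qed.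

Lemma rd_side_left t : ~ right_dense T a b t -> left_dense T a b t ->
  rd_sides T a b t (I `&` [set s | s < t]).
Proof. by move=> nd ld; right; split=> //; right. Qed.

Lemma rd_side_dense t : right_dense T a b t -> rd_sides T a b t I.
Proof. by move=> d; left. Qed.

Lemma rd_side_sub t A : I t -> rd_sides T a b t A -> A `<=` I.
Proof.
by move=> It [[_ ->]//|[_ [->|[_ ->]]]] => s //= => [->|[]].
Qed.

(** Turns estimates along one-sided sets into estimates at [t] itself, which the left part of a
    left-dense point does not contain. *)
Lemma rd_side_mem t : I t -> exists2 A, rd_sides T a b t A & A t.
Proof.
move=> It; have [d|nd] := pselect (right_dense T a b t).
  by exists I => //; exact: rd_side_dense.
by exists [set t] => //; exact: rd_side_singleton.
Qed.

(* The sets in [rd_sides t] together cover a neighbourhood of [t] in the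
   interval, so that properties along them can be glued by compactness. *)
Lemma rd_compact (J : Type) (F : set_system J) (FF : Filter F)
    (P : J -> R -> Prop) :
  (forall t, I t -> forall A, rd_sides T a b t A -> exists2 d : R, 0 < d &
     \forall j \near F, forall s, A s -> `|s - t| < d -> P j s) ->
  \forall j \near F, forall s, I s -> P j s.
Proof.
move=> h.
have cov := (compact_near_coveringP _).1 tsI_compact J F (fun j s => I s -> P j s) FF.
have : \forall j \near F, I `<=` (fun s => I s -> P j s).
  apply: cov => t It.
  suff [d d0 hd] : exists2 d : R, 0 < d &
      \forall j \near F, forall s, I s -> `|s - t| < d -> P j s.
    exists (ball t d, [set j | forall s, I s -> `|s - t| < d -> P j s]).
      by split=> //=; exact: nbhsx_ballx.
    by move=> [s j] /= [sd Pj] Is; apply: Pj => //; rewrite distrC.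
  have [rd|nrd] := pselect (right_dense T a b t).
    exact: h (rd_side_dense _ rd).
  have [d1 d10 h1] := h _ It _ (rd_side_singleton _ nrd).
  have [d2 d20 h2] := gap_right _ It nrd.
  have [ld|nld] := pselect (left_dense T a b t).
    have [d3 d30 h3] := h _ It _ (rd_side_left _ nrd ld).
    exists (Num.min d1 (Num.min d2 d3)).
      by rewrite !lt_min d10 d20.
    apply: filterS2 h1 h3 => j h1 h3 s Is; rewrite !lt_min => /and3P[s1 s2 s3].
    by have := h2 _ Is s2; rewrite le_eqVlt => /predU1P[st|st]; [exact: h1|exact: h3].
  have [d3 d30 h3] := gap_left _ It nld.
  exists (Num.min d1 (Num.min d2 d3)).
    by rewrite !lt_min d10 d20.
  apply: filterS h1 => j h1 s Is; rewrite !lt_min => /and3P[s1 s2 s3].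
  apply: h1 => //=; apply/eqP; rewrite eq_le h2//= h3//.
by apply: filterS => j hj s Is; exact: hj.
Qed.

(** * Rd-continuity as a Cauchy condition *)

Definition rd_cauchy (h : R -> R) : Prop :=
  forall t, I t -> forall A, rd_sides T a b t A -> forall e : R, 0 < e ->
  exists2 d : R, 0 < d & forall s s', A s -> A s' -> `|s - t| < d ->
    `|s' - t| < d -> `|h s - h s'| <= e.

Lemma rd_continuous_lim h : rd_continuous T a b h ->
  forall t, I t -> forall A, rd_sides T a b t A -> exists l,
  (forall e : R, 0 < e -> exists2 d : R, 0 < d & forall s, A s -> `|s - t| < d ->
    `|h s - l| <= e).
Proof.
move=> [h1 h2] t It A [[rd ->]|[_ [->|[ld ->]]]].
- by exists (h t); apply/cvg_within_distP; exact: h1.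
- by exists (h t) => e e0; exists 1 => // s -> _; rewrite subrr normr0 ltW.
- by have [l hl] := h2 _ ld; exists l; apply/cvg_within_distP.
Qed.

Lemma rd_continuous_cauchy h : rd_continuous T a b h -> rd_cauchy h.
Proof.
move=> hc t It A sA e e0; have [l hl] := rd_continuous_lim h hc _ It _ sA.
have [d d0 hd] := hl (e / 2) ltac:(by rewrite divr_gt0); exists d => // s s' As As' sd sd'.
rewrite (splitr e) (le_trans (ler_distD l _ _))// lerD//; first exact: hd.
by rewrite distrC; exact: hd.
Qed.

(** [rd_cauchy] never names the limit value, which suits functions known only through a modulus;
    completeness of the reals recovers the left limits. *)
Lemma rd_cauchy_continuous h : rd_cauchy h -> rd_continuous T a b h.
Proof.
move=> hc; split=> [t rd|t ld].
  have It : I t by case: rd.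
  apply/cvg_within_distP => e e0.
  have [d d0 hd] := hc _ It _ (rd_side_dense _ rd) _ e0.
  by exists d => // s Is sd; apply: hd => //; rewrite subrr normr0.
have It : I t by case: ld.
set A := I `&` [set s | s < t].
have hA (e : R) : 0 < e -> exists2 d : R, 0 < d & forall s s', A s -> A s' ->
    `|s - t| < d -> `|s' - t| < d -> `|h s - h s'| <= e.
  move=> e0; have [rd|nrd] := pselect (right_dense T a b t).
    have [d d0 hd] := hc _ It _ (rd_side_dense _ rd) _ e0.
    by exists d => // s s' [As _] [As' _]; exact: hd.
  exact: hc (rd_side_left _ nrd ld) _ e0.
(* An improper filter converges to every number, so [0] serves; this replaces a proof that [t] is a
   limit point of [A]. *)
have [P|nP] := pselect (ProperFilter (within A (nbhs t))); last first.
  exists 0 => S _; apply: contrapT => nS; apply: nP; split; last exact: within_filter.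
  move=> w0; apply: nS; apply: filterS w0 => ? [].
suff /cauchy_cvgP : cauchy (h @ within A (nbhs t)) by move=> /cvg_ex.
apply/cauchy_exP => e e0.
have [d d0 hd] := hA (e / 2) ltac:(by rewrite divr_gt0).
have [s [As sd]] : exists s, A s /\ `|s - t| < d.
  have : within A (nbhs t) (A `&` [set s | `|s - t| < d]).
    by apply/near_within_distP; exists d.
  by move/filter_ex => [s []]; exists s.
exists (h s); apply/near_within_distP; exists d => // s' As' sd'.
rewrite /ball /= (le_lt_trans (hd _ _ As As' sd sd'))// ltr_pdivrMr// ltr_pMr//.
by rewrite ltr1n.
Qed.

(** Along each side of a point, [1] plus the absolute value of the limit is a local bound;
    [rd_compact] glues these as [M] tends to infinity. *)
Lemma rd_bounded h : rd_continuous T a b h ->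
  exists2 M : R, 0 < M & forall t, I t -> `|h t| <= M.
Proof.
move=> hc.
suff H : \forall M \near +oo, forall t, I t -> `|h t| <= M.
  have [M [M0 hM]] : exists M : R, 0 < M /\ forall t, I t -> `|h t| <= M.
    apply: (@filter_ex _ +oo).
    by apply: filterI H; exact: nbhs_pinfty_gt.
  by exists M.
apply: rd_compact => t It A sA.
have [l hl] := rd_continuous_lim _ hc _ It _ sA.
have [d d0 hd] := hl 1 ltr01; exists d => //.
apply: filterS (nbhs_pinfty_ge (num_real (1 + `|l|))) => M hM s As sd.
have -> : h s = (h s - l) + l by rewrite subrK.
rewrite (le_trans (ler_normD _ _))// (le_trans _ hM)// lerD2r.
exact: hd.
Qed.

(** * Upper Darboux integral on the time scale *)

Section UpperIntegral.
Variable g : R -> R.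

(** Upper Darboux sums, built by concatenation instead of lists of division points. Cells are
    half-open, [s, t), because the delta integral weights the value at a right-scattered point by
    the gap to its right. *)
Inductive upper_sum : R -> R -> R -> Prop :=
| upper_sum_step s t c : I s -> I t -> s <= t ->
    (forall r, I r -> s <= r -> r < t -> g r <= c) -> upper_sum s t (c * (t - s))
| upper_sum_cat s r t x y : upper_sum s r x -> upper_sum r t y ->
    upper_sum s t (x + y).

Lemma upper_sum_dom s t x : upper_sum s t x -> [/\ I s, I t & s <= t].
Proof.
elim=> [//|{}s r {}t {}x y _ [Is _ sr] _ [_ It rt]].
by split=> //; exact: le_trans rt.
Qed.

Lemma upper_sum_ge m s t x : upper_sum s t x ->
  (forall r, I r -> s <= r -> r < t -> m <= g r) -> m * (t - s) <= x.
Proof.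
elim=> [{}s {}t c Is It + hc hm|{}s r {}t {}x y h1 IH1 h2 IH2 hm].
  rewrite le_eqVlt => /predU1P[->|st]; first by rewrite subrr !mulr0.
  by rewrite ler_pM2r ?subr_gt0// (le_trans (hm s _ _ _))// hc.
have [Is Ir sr] := upper_sum_dom _ _ _ h1.
have [_ It rt] := upper_sum_dom _ _ _ h2.
have -> : m * (t - s) = m * (r - s) + m * (t - r) by ring.
apply: lerD.
  by apply: IH1 => u Iu su ur; apply: hm => //; exact: lt_le_trans rt.
by apply: IH2 => u Iu su ur; apply: hm => //; exact: le_trans su.
Qed.

(** Cutting a cell at [t] keeps its constant and splits its length. Together with concatenation this
    yields additivity of the integral. *)
Lemma upper_sum_split s u x : upper_sum s u x -> forall t, I t -> s <= t -> t <= u ->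
  exists y z, [/\ upper_sum s t y, upper_sum t u z & x = y + z].
Proof.
elim=> [{}s {}u c Is Iu su hc t It st tu|{}s r {}u {}x y h1 IH1 h2 IH2 t It st tu].
  exists (c * (t - s)), (c * (u - t)); split; last by ring.
    by apply: upper_sum_step => // r Ir sr rt; apply: hc => //; exact: lt_le_trans tu.
  by apply: upper_sum_step => // r Ir sr rt; apply: hc => //; exact: le_trans sr.
have [tr|/ltW rt] := leP t r.
  have [x1 [x2 [hx1 hx2 ->]]] := IH1 t It st tr.
  exists x1, (x2 + y); split=> //; last by rewrite addrA.
  exact: upper_sum_cat h2.
have [x1 [x2 [hx1 hx2 ->]]] := IH2 t It rt tu.
exists (x + x1), x2; split=> //; last by rewrite addrA.
exact: upper_sum_cat hx1.
Qed.

(** Meaningful for [s <= t] in the interval and bounded [g], where the set is nonempty and bounded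
    below; elsewhere [inf] may return its default. *)
Definition upper_integral (s t : R) : R := inf (upper_sum s t).

Variable M : R.
Hypothesis hM : forall t, I t -> `|g t| <= M.

Let g_le t : I t -> g t <= M.
Proof. by move=> /hM; rewrite ler_norml => /andP[]. Qed.

Let g_ge t : I t -> - M <= g t.
Proof. by move=> /hM; rewrite ler_norml => /andP[]. Qed.

Let upper_sum_bounded s t : has_lbound (upper_sum s t).
Proof. by exists (- M * (t - s)) => x hx; apply: upper_sum_ge hx _ => r /g_ge. Qed.

Let upper_sum_nonempty s t : I s -> I t -> s <= t -> upper_sum s t !=set0.
Proof.
move=> Is It st; exists (M * (t - s)); apply: upper_sum_step => // r Ir _ _.
exact: g_le.
Qed.

Lemma upper_integral_le c s t : I s -> I t -> s <= t ->
  (forall r, I r -> s <= r -> r < t -> g r <= c) -> upper_integral s t <= c * (t - s).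
Proof. by move=> Is It st hc; apply: ge_inf => //; exact: upper_sum_step. Qed.

Lemma upper_integral_ge m s t : I s -> I t -> s <= t ->
  (forall r, I r -> s <= r -> r < t -> m <= g r) -> m * (t - s) <= upper_integral s t.
Proof.
move=> Is It st hm; apply: lb_le_inf; first exact: upper_sum_nonempty.
by move=> x hx; exact: upper_sum_ge hm.
Qed.

Lemma upper_integral_near c e s t : I s -> I t -> s <= t ->
  (forall r, I r -> s <= r -> r < t -> `|g r - c| <= e) ->
  `|upper_integral s t - c * (t - s)| <= e * (t - s).
Proof.
move=> Is It st h; rewrite ler_distl -mulrBl -mulrDl.
apply/andP; split; [apply: upper_integral_ge|apply: upper_integral_le] => // r Ir sr rt;
  by have := h r Ir sr rt; rewrite ler_distl => /andP[].
Qed.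

Lemma upper_integral_add s t u : I s -> I t -> I u -> s <= t -> t <= u ->
  upper_integral s u = upper_integral s t + upper_integral t u.
Proof.
move=> Is It Iu st tu; apply/eqP; rewrite eq_le; apply/andP; split.
  rewrite -lerBlDr; apply: lb_le_inf; first exact: upper_sum_nonempty.
  move=> x hx; rewrite lerBlDr -lerBlDl; apply: lb_le_inf.
    exact: upper_sum_nonempty.
  move=> y hy; rewrite lerBlDl; apply: ge_inf => //.
  exact: upper_sum_cat hy.
apply: lb_le_inf; first by apply: upper_sum_nonempty => //; exact: le_trans tu.
move=> x hx; have [y [z [hy hz ->]]] := upper_sum_split _ _ _ hx t It st tu.
by apply: lerD; exact: ge_inf.
Qed.

End UpperIntegral.

(** At a right-dense point, continuity makes [g] nearly constant on short intervals. At a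
    right-scattered point the integral over the jump is exactly [g t] times its length, and the rest
    is small by boundedness. *)
Lemma upper_integral_antiderivative g : rd_continuous T a b g ->
  is_antiderivative T a b g (upper_integral g a).
Proof.
move=> gc; have [M M0 hM] := rd_bounded _ gc.
set U := upper_integral g.
have UB s t : I s -> I t -> s <= t -> U a t - U a s = U s t.
  move=> Is It st; rewrite /U (upper_integral_add g M hM a s t)//.
  - by rewrite addrC addKr.
  - exact: tsI_left.
  - by case/andP: (tsI_bounds _ Is).
split=> [t It tb e e0|]; last first.
  apply/cvg_within_distP => e e0; exists (e / M); first exact: divr_gt0.
  move=> s Is; have sb : s <= b by case/andP: (tsI_bounds _ Is).
  rewrite ltr_pdivlMr// => /ltW sd; rewrite distrC UB//; last exact: tsI_right.
  have := upper_integral_near g M hM 0 M s b Is tsI_right sb.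
  rewrite mul0r subr0 => /(_ _)/le_trans; apply.
    by move=> r Ir _ _; rewrite subr0; exact: hM.
  by rewrite mulrC -(ger0_norm (_ : 0 <= b - s)) ?subr_ge0// distrC.
have [rd|nrd] := pselect (right_dense T a b t).
  have -> : sigma T t = t by case: rd.
  have [/(_ _ rd)/cvg_within_distP/(_ _ e0)[d d0 hd] _] := gc.
  apply/near_within_distP; exists d => // s Is sd.
  have [st|/ltW ts] := leP s t.
    rewrite UB// (@ger0_norm _ (t - s)) ?subr_ge0//.
    apply: (upper_integral_near _ M) => // r Ir sr rt; apply: hd => //.
    apply: le_lt_trans sd; rewrite !ler0_norm; lra.
  rewrite (_ : `|t - s| = s - t); last by rewrite ler0_norm; lra.
  rewrite -[leLHS]normrN.
  have -> : - (U a t - U a s - g t * (t - s)) = U t s - g t * (s - t).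
    by rewrite -(UB t s)//; ring.
  apply: (upper_integral_near _ M) => // r Ir sr rt; apply: hd => //.
  apply: le_lt_trans sd; rewrite !ger0_norm; lra.
have ts : t < sigma T t.
  rewrite lt_neqAle sigma_ge// andbT; apply/eqP => ts.
  by apply: nrd; split.
have Is := tsI_sigma _ It tb.
have [d1 d10 h1] := gap_right _ It nrd.
(* Chosen so that the error on [s, t), at most [2M (t - s)], stays below [e * (sigma T t - t)],
   hence below [e * (sigma T t - s)]. *)
pose d2 := e * (sigma T t - t) / (M *+ 2).
have d20 : 0 < d2 by rewrite divr_gt0 ?mulr_gt0 ?subr_gt0// mulrn_wgt0.
apply/near_within_distP; exists (Num.min d1 d2); first by rewrite lt_min d10.
move=> s Iss; rewrite lt_min => /andP[sd1 sd2].
have st := h1 _ Iss sd1.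
have -> : U a (sigma T t) - U a s - g t * (sigma T t - s) =
   (U s t - g t * (t - s)) + (U t (sigma T t) - g t * (sigma T t - t)).
  rewrite -(UB s t)// -(UB t (sigma T t))//; first by ring.
  exact: ltW.
(* No point of the interval other than [t] lies in [t, sigma t), so the estimate holds with error
   [0]. *)
have -> : U t (sigma T t) = g t * (sigma T t - t).
  apply/eqP; rewrite -subr_eq0 -normr_le0 -(mul0r (sigma T t - t)).
  apply: (upper_integral_near _ M) => //; first exact: ltW.
  move=> r Ir tr rs; suff -> : r = t by rewrite subrr normr0.
  apply/eqP; rewrite eq_le tr andbT leNgt; apply/negP => ltr.
  by have := sigma_le _ _ It Ir.1 ltr; rewrite leNgt rs.
rewrite subrr addr0 (@ger0_norm _ (sigma T t - s)) ?subr_ge0; last first.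
  by rewrite (le_trans st)// ltW.
apply: (@le_trans _ _ ((M *+ 2) * (t - s))).
  apply: (upper_integral_near _ M) => // r Ir _ _.
  by rewrite (le_trans (ler_normB _ _))// mulr2n lerD// hM.
move: sd2; rewrite /d2 distrC ger0_norm ?subr_ge0// ltr_pdivlMr ?mulrn_wgt0//.
rewrite mulrC => /ltW/le_trans; apply.
by apply: ler_wpM2l; [exact: ltW|lra].
Qed.

(** * Mean value inequality for antiderivatives *)

Lemma delta_derive_comb (F G : R -> R) p q c t :
  is_delta_derive T a b F t p -> is_delta_derive T a b G t q ->
  is_delta_derive T a b (fun s => G s - F s + c * s) t (q - p + c).
Proof.
move=> hF hG e e0; have e2 : 0 < e / 2 by rewrite divr_gt0.
apply: filterS2 (hF _ e2) (hG _ e2) => s; set X := `|_|; set x := `|_ - s| => h1 h2.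
rewrite (_ : G _ - _ + _ - _ - _ = (G (sigma T t) - G s - q * (sigma T t - s)) -
  (F (sigma T t) - F s - p * (sigma T t - s))); last by ring.
rewrite (le_trans (ler_normB _ _))// (_ : e * x = e / 2 * x + e / 2 * x).
  exact: lerD.
by rewrite -mulrDl -splitr.
Qed.

Lemma antiderivative_comb (f g F G : R -> R) c :
  is_antiderivative T a b f F -> is_antiderivative T a b g G ->
  is_antiderivative T a b (fun t => g t - f t + c) (fun s => G s - F s + c * s).
Proof.
move=> [hF Fb] [hG Gb]; split=> [t It tb|].
  by apply: delta_derive_comb; [exact: hF|exact: hG].
apply: cvgD; first exact: cvgB.
apply: cvgMr; apply: cvg_within_filter; exact: cvg_id.
Qed.

(** The derivative estimate at [t], taken once at [s] and once at [t] itself, eliminates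
    [F (sigma T t)] from [F s - F t]. *)
Lemma antiderivative_continuous (g F : R -> R) t : is_antiderivative T a b g F ->
  I t -> F @ within I (nbhs t) --> F t.
Proof.
move=> [hF Fb] It; have [tb|bt] := ltP t b; last first.
  suff -> : t = b by [].
  by apply/eqP; rewrite eq_le bt; case/andP: (tsI_bounds _ It) => _ ->.
have st := sigma_ge _ It tb.
set r := sigma T t in st *; set k := `|g t|.
have k0 : 0 <= k by exact: normr_ge0.
apply/cvg_within_distP => e e0.
(* For [|s - t| < 1] the weights [|r - t|] and [|r - s|] add up to at most [2 * (r - t) + 1], so
   [e1] keeps both errors within [e / 2]. *)
pose e1 := e / 2 / (2 * (r - t) + 1).
have r1 : 0 < 2 * (r - t) + 1 by lra.
have e10 : 0 < e1 by rewrite !divr_gt0.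
have [d d0 hd] := (near_within_distP _ _ _ _).1 (hF t It tb e1 e10).
exists (Num.min d (Num.min 1 (e / 2 / (k + 1)))).
  by rewrite !lt_min d0 ltr01 !divr_gt0// ltr_wpDl.
move=> s Is; rewrite !lt_min => /and3P[sd s1 sk].
have h1 := hd s Is sd.
have h2 : `|F r - F t - g t * (r - t)| <= e1 * `|r - t|.
  by apply: hd => //; rewrite subrr normr0.
rewrite (_ : F s - F t = (F r - F t - g t * (r - t)) - (F r - F s - g t * (r - s))
  + g t * (s - t)); last by ring.
rewrite (le_trans (ler_normD _ _))// (splitr e) lerD//.
  rewrite (le_trans (ler_normB _ _))//.
  have -> : e / 2 = e1 * (2 * (r - t) + 1) by rewrite /e1 divfK// gt_eqF.
  apply: (le_trans (lerD h2 h1)); rewrite -mulrDr ler_pM2l//.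
  rewrite (ger0_norm (_ : 0 <= r - t)) ?subr_ge0//.
  rewrite (_ : r - s = (r - t) - (s - t)); last by ring.
  have := ler_normB (r - t) (s - t).
  rewrite (ger0_norm (_ : 0 <= r - t)) ?subr_ge0//; lra.
rewrite normrM -/k (@le_trans _ _ ((k + 1) * `|s - t|))//.
  by rewrite ler_wpM2r// lerDl.
by rewrite mulrC -ler_pdivlMr ?ltW// ltr_wpDl.
Qed.

(** Induction along the time scale: [c] is the supremum of the points up to which [F] stays above
    [F s]. Continuity puts [c] in [S], and if [c < b], positivity of [g c] extends the range beyond
    [c], a contradiction. *)
Lemma antiderivative_increasing (g F : R -> R) s t : is_antiderivative T a b g F ->
  (forall r, I r -> r < b -> 0 < g r) -> I s -> I t -> s <= t -> F s <= F t.
Proof.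
move=> hF g0 Is It st; have Fc u := antiderivative_continuous g F u hF.
pose S := [set u | [/\ I u, s <= u & forall r, I r -> s <= r -> r <= u -> F s <= F r]].
have Ss : S s.
  split=> // r _ sr rs; suff -> : r = s by [].
  by apply/eqP; rewrite eq_le rs.
have supS : has_sup S.
  by split; [exists s|exists b => u [Iu _ _]; case/andP: (tsI_bounds _ Iu)].
set c := sup S.
have Sc u : S u -> u <= c by move=> Su; exact: (ub_le_sup supS.2).
have Sadh d : 0 < d -> exists u, [/\ S u, u <= c & c - d < u].
  by move=> d0; have [u Su ud] := sup_adherent d0 supS; exists u; split=> //; exact: Sc.
have Ic : I c.
  apply: tsI_closed => d d0; have [u [[Iu _ _] uc ud]] := Sadh d d0.
  by exists u => //; rewrite distrC ger0_norm ?subr_ge0//; lra.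
have below r : I r -> s <= r -> r < c -> F s <= F r.
  move=> Ir sr rc; have cr : 0 < c - r by rewrite subr_gt0.
  have [u [[_ _ hu] _ ur]] := Sadh _ cr; apply: hu => //; lra.
have Fsc : F s <= F c.
  apply/ler_addgt0Pr => e e0; have [d d0 hd] := (cvg_within_distP _ _ _ _ _).1 (Fc c Ic) e e0.
  have [u [[Iu su hu] uc ud]] := Sadh d d0.
  have := hd u Iu; rewrite distrC ger0_norm ?subr_ge0// => /(_ ltac:(lra)).
  by rewrite ler_distl => /andP[_]; have := hu u Iu su (lexx u); lra.
have SSc : S c.
  split=> //; first exact: Sc.
  by move=> r Ir sr; rewrite le_eqVlt => /predU1P[->//|]; exact: below.
have [cb|bc] := ltP c b; last first.
  have [_ sb] := andP (tsI_bounds _ It).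
  by case: SSc => _ _ h; apply: h => //; exact: le_trans bc.
have gc := g0 c Ic cb.
have cs := sigma_ge _ Ic cb.
(* Taking [g c] itself as tolerance reduces the derivative estimate to [F c <= F (sigma T c)] and,
   when [c] is right-dense, to [F c <= F r] for nearby [r > c]. *)
have [d d0 hd] := (near_within_distP _ _ _ _).1 (hF.1 c Ic cb _ gc).
have jump : F c <= F (sigma T c).
  have := hd c Ic; rewrite subrr normr0 => /(_ d0).
  rewrite (@ger0_norm _ (sigma T c - c)) ?subr_ge0//.
  by rewrite ler_distlC => /andP[]; lra.
suff [u [Su cu]] : exists u, S u /\ c < u.
  by have := Sc u Su; rewrite leNgt cu.
have extend u : I u -> c < u -> (forall r, I r -> c < r -> r <= u -> F c <= F r) -> S u.
  move=> Iu cu h; split=> //; first by rewrite (le_trans (Sc _ Ss))// ltW.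
  move=> r Ir sr ru; have [rc|cr] := leP r c; first by case: SSc => _ _; exact.
  by rewrite (le_trans Fsc)// h.
move: cs; rewrite le_eqVlt => /predU1P[cs|cs].
  have [u [Iu cu ud]] := sigma_approx _ d Ic cb d0.
  exists u; split=> //; apply: extend => // r Ir cr ru.
  have := hd r Ir; rewrite -cs (@gtr0_norm _ (r - c)) ?subr_gt0//.
  move=> /(_ ltac:(lra)); rewrite (@ltr0_norm _ (c - r)) ?subr_lt0//.
  by rewrite ler_distlC => /andP[]; lra.
exists (sigma T c); split=> //; apply: extend => //; first exact: tsI_sigma.
move=> r Ir cr rs; suff -> : r = sigma T c by [].
by apply/eqP; rewrite eq_le rs sigma_le//; case: Ir.
Qed.

(** [H - F] plus a line of slope [e + y] has strictly positive derivative, so it increases. *)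
Lemma antiderivative_le (g h F H : R -> R) e s t :
  is_antiderivative T a b g F -> is_antiderivative T a b h H ->
  (forall r, I r -> g r <= h r + e) -> I s -> I t -> s <= t ->
  F t - F s <= H t - H s + e * (t - s).
Proof.
move=> hF hH gh Is It st; apply/ler_addgt0Pr => x x0.
(* Keeps the surplus [y * (t - s)] at most [x]; the [1] makes the divisor positive when [s = t]. *)
pose y := x / (t - s + 1).
have ts : 0 < t - s + 1 by lra.
have y0 : 0 < y by rewrite divr_gt0.
have hG := antiderivative_comb _ _ _ _ (e + y) hF hH.
have := antiderivative_increasing _ _ _ _ hG _ Is It st.
have : y * (t - s) <= x.
  by rewrite /y mulrAC ler_pdivrMr// ler_wpM2l//; [exact: ltW|lra].
have pos r : I r -> r < b -> 0 < h r - g r + (e + y).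
  by move=> Ir _; have := gh r Ir; lra.
move=> xy /(_ pos); rewrite !mulrDl; move: xy; rewrite !mulrBr; lra.
Qed.

(** * Bounds for the delta integral *)

Lemma delta_integralP (g : R -> R) : rd_continuous T a b g ->
  exists2 F, is_antiderivative T a b g F &
    forall s t, delta_integral T a b g s t = F t - F s.
Proof.
move=> hg; eexists; last by [].
exact: (xgetPex (cst 0) (ex_intro _ _ (upper_integral_antiderivative g hg))).
Qed.

Lemma delta_integral_le (g h : R -> R) e s t :
  rd_continuous T a b g -> rd_continuous T a b h ->
  (forall r, I r -> g r <= h r + e) -> I s -> I t -> s <= t ->
  delta_integral T a b g s t <= delta_integral T a b h s t + e * (t - s).
Proof.
move=> /delta_integralP[F hF ->] /delta_integralP[H hH ->].
exact: antiderivative_le.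
Qed.

Lemma delta_integral_dist (g h : R -> R) e s t :
  rd_continuous T a b g -> rd_continuous T a b h ->
  (forall r, I r -> `|g r - h r| <= e) -> I s -> I t -> s <= t ->
  `|delta_integral T a b g s t - delta_integral T a b h s t| <= e * (t - s).
Proof.
move=> hg hh gh Is It st; rewrite ler_distl lerBlDr; apply/andP; split.
  apply: delta_integral_le => // r /gh; rewrite ler_distl => /andP[]; lra.
by apply: delta_integral_le => // r /gh; rewrite ler_distl => /andP[].
Qed.

Lemma delta_integral_increment (g : R -> R) M s t : rd_continuous T a b g ->
  (forall r, I r -> `|g r| <= M) -> I s -> I t ->
  `|delta_integral T a b g a t - delta_integral T a b g a s| <= M * `|t - s|.
Proof.
move=> hg gM Is It; wlog st : s t Is It / s <= t.
  move=> W; have [/W|/ltW/W] := leP s t; first exact.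
  by rewrite distrC (distrC t); exact.
rewrite (@ger0_norm _ (t - s)) ?subr_ge0//.
have [F hF FE] := delta_integralP _ hg; rewrite !FE.
rewrite (_ : F t - F a - (F s - F a) = F t - F s); last by ring.
have h0 : is_antiderivative T a b (cst 0) (cst 0).
  split; last exact: cvg_cst.
  move=> r _ _ e e0; near=> u.
  by rewrite !subrr mul0r subr0 normr0 mulr_ge0// ltW.
have bnd r : I r -> - M <= g r <= M by move=> /gM; rewrite ler_norml.
have le1 : F t - F s <= cst 0 t - cst 0 s + M * (t - s).
  by apply: (antiderivative_le g (cst 0)) => // r /bnd/andP[_]; rewrite /cst add0r.
have le2 : cst 0 t - cst 0 s <= F t - F s + M * (t - s).
  apply: (antiderivative_le (cst 0) g) => // r /bnd/andP[]; rewrite /cst; lra.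
by rewrite ler_norml; apply/andP; move: le1 le2; rewrite /cst; split; lra.
Unshelve. all: by end_near. Qed.

(** * Uniform estimates for the kernel *)

Section Kernel.
Variables (f : R -> R) (k : R -> R -> R -> R).
Hypotheses (hf : rd_continuous T a b f) (hk : rd_continuous3 T a b k).

Lemma kernel_cauchy t0 s0 p0 A B e : I t0 -> I s0 ->
  rd_sides T a b t0 A -> rd_sides T a b s0 B -> 0 < e ->
  exists2 d : R, 0 < d & forall t t' s s' p p', A t -> A t' -> B s -> B s' ->
    `|t - t0| < d -> `|t' - t0| < d -> `|s - s0| < d -> `|s' - s0| < d ->
    `|p - p0| < d -> `|p' - p0| < d -> `|k t s p - k t' s' p'| <= e.
Proof.
move=> It Is sA sB e0; have [l [hl _]] := hk _ _ p0 It Is _ _ sA sB.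
have e2 : 0 < e / 2 by rewrite divr_gt0.
move/cvgrPdist_le : hl => /(_ _ e2); rewrite near_withinE => /nbhs_ballP[d /= d0 hd].
have {}hd t s p : A t -> B s -> `|t - t0| < d -> `|s - s0| < d -> `|p - p0| < d ->
    `|l - k t s p| <= e / 2.
  move=> At Bs td sd pd; apply: (hd (t, s, p)) => //.
  by split; [split|]; rewrite /ball /= distrC.
exists d => // t t' s s' p p' At At' Bs Bs' td td' sd sd' pd pd'.
rewrite (splitr e) (le_trans (ler_distD l _ _))// lerD//; last exact: hd.
by rewrite distrC; exact: hd.
Qed.

(** Two layers of compactness, in [p] over [-M, M] and then in [s] over the interval, while [t]
    stays near [t0] along [A]. The radius [d] runs along [0^'+], so that finitely many local radii
    can be met at once. *)
Lemma kernel_uniform t0 A M e : I t0 -> rd_sides T a b t0 A -> 0 < e ->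
  exists2 d : R, 0 < d & forall t t' s p p', A t -> A t' -> I s ->
    `|t - t0| < d -> `|t' - t0| < d -> `|p| <= M -> `|p - p'| < d ->
    `|k t s p - k t' s p'| <= e.
Proof.
move=> It sA e0.
suff H : \forall d \near 0^'+, forall s, I s -> forall t t' p p', A t -> A t' ->
    `|t - t0| < d -> `|t' - t0| < d -> `|p| <= M -> `|p - p'| < d ->
    `|k t s p - k t' s p'| <= e.
  have [d [d0 hd]] := filter_ex (filterI (nbhs_right_gt 0) H).
  by exists d => // t t' s p p' At At' Is; exact: hd.
apply: rd_compact => s0 Is0 B sB.
pose Q d p := forall s t t' p', B s -> A t -> A t' -> `|s - s0| < d ->
  `|t - t0| < d -> `|t' - t0| < d -> `|p - p'| < d -> `|k t s p - k t' s p'| <= e.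
have : \forall d \near 0^'+, `[- M, M]%classic `<=` Q d.
  apply: ((compact_near_coveringP _).1 (@segment_compact _ (- M) M)) => p0 _.
  have [d d0 hd] := kernel_cauchy _ _ p0 _ _ _ It Is0 sA sB e0.
  have d20 : 0 < d / 2 by rewrite divr_gt0.
  exists (ball p0 (d / 2), [set x | x <= d / 2]).
    by split=> /=; [exact: nbhsx_ballx|exact: nbhs_right_le].
  move=> [p x] /= []; rewrite /ball /= => pp0 xd s t t' p' Bs At At' sx tx tx' px.
  by apply: hd => //; rewrite ?(distrC _ p0); have := ler_distD p p0 p'; lra.
move=> H; have [d [/= d0 hd]] := filter_ex (filterI (nbhs_right_gt 0) H).
exists d => //; apply: filterS (nbhs_right_le d0) => x xd s Bs sd t t' p p' At At'.
move=> tx tx' pM px; apply: hd => //; try exact: lt_le_trans xd.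
by rewrite /= in_itv /= -ler_norml.
Qed.

(** Along a side of [s0] the values of [x] tend to some [l], and the kernel is nearly constant
    around [p0 = l], even where [l] differs from [x s0]. *)
Lemma kernel_comp_rd t x : I t -> rd_continuous T a b x ->
  rd_continuous T a b (fun s => k t s (x s)).
Proof.
move=> It hx; apply: rd_cauchy_continuous => s0 Is0 B sB e e0.
have [l hl] := rd_continuous_lim _ hx _ Is0 _ sB.
have [A sA At] := rd_side_mem _ It.
have [d d0 hd] := kernel_cauchy _ _ l _ _ _ It Is0 sA sB e0.
have d20 : 0 < d / 2 by rewrite divr_gt0.
have [r r0 hr] := hl _ d20.
exists (Num.min d r); first by rewrite lt_min d0.
move=> s s' Bs Bs'; rewrite !lt_min => /andP[sd sr] /andP[sd' sr'].
have xd u : B u -> `|u - s0| < r -> `|x u - l| < d.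
  by move=> Bu ur; have := hr u Bu ur; lra.
by apply: hd => //; rewrite ?subrr ?normr0 ?xd.
Qed.

Hypothesis hkmono : forall t s p q : R, I t -> I s -> p <= q -> k t s p <= k t s q.

(** Monotonicity traps [k t s p] between [k t s (- M)] and [k t s M], so it is enough to bound the
    kernel at constants [q]. *)
Lemma kernel_bounded M : exists2 C : R, 0 < C &
  forall t s p, I t -> I s -> `|p| <= M -> `|k t s p| <= C.
Proof.
have bnd q : \forall C \near +oo, forall t, I t -> forall s, I s -> `|k t s q| <= C.
  apply: rd_compact => t0 It0 A sA.
  have [d d0 hd] := kernel_uniform _ _ `|q| 1 It0 sA ltr01.
  (* [t0] may lie outside [A], so a nearby point [t1] of [A] serves as reference; if there is none,
     the bound is vacuous. *)
  exists d => //; have [[t1 At1 td1]|no] := pselect (exists2 t1, A t1 & `|t1 - t0| < d).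
    have hq : rd_continuous T a b (cst q).
      split=> [t _|t _]; first exact: cvg_cst.
      by exists q; exact: cvg_cst.
    have [C C0 hC] := rd_bounded _ (kernel_comp_rd t1 _ (rd_side_sub _ _ It0 sA _ At1) hq).
    apply: filterS (nbhs_pinfty_ge (num_real (1 + C))) => D CD t At td s Is.
    rewrite -(subrK (k t1 s q) (k t s q)) (le_trans (ler_normD _ _))//.
    by rewrite (le_trans _ CD)// lerD ?hC// hd// subrr normr0.
  by near=> C => t At td; exfalso; apply: no; exists t.
have [C [C0 [h1 h2]]] :=
  filter_ex (filterI (nbhs_pinfty_gt (num_real 0)) (filterI (bnd M) (bnd (- M)))).
exists C => // t s p It Is; rewrite ler_norml => /andP[pM1 pM2].
move: (h1 t It s Is) (h2 t It s Is); rewrite !ler_norml => /andP[_ u1] /andP[u2 _].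
by rewrite (le_trans u2) ?hkmono// (le_trans _ u1)// hkmono.
Unshelve. all: by end_near. Qed.

(** * The Volterra operator: equicontinuity, continuity, monotonicity *)

Local Notation V := (volterra T a b f k).

(** The difference splits into the change of [f], the integral between [t'] and [t], and the change
    of the kernel from [t'] to [t], each at most [e / 3]. The radius depends on [x] only through
    [M]. *)
Lemma volterra_equicontinuous t0 A M e : I t0 -> rd_sides T a b t0 A -> 0 < e ->
  exists2 d : R, 0 < d & forall x, rd_continuous T a b x ->
    (forall s, I s -> `|x s| <= M) -> forall t t', A t -> A t' ->
    `|t - t0| < d -> `|t' - t0| < d -> `|V x t - V x t'| <= e.
Proof.
move=> It0 sA e0; have [C C0 hC] := kernel_bounded M.
have ba : 0 < b - a by rewrite subr_gt0.
have e3 : 0 < e / 3 by rewrite divr_gt0.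
have [d1 d10 h1] := rd_continuous_cauchy _ hf _ It0 _ sA _ e3.
have eta0 : 0 < e / 3 / (b - a) by rewrite divr_gt0.
have [d2 d20 h2] := kernel_uniform _ _ M _ It0 sA eta0.
(* Two points within [d3] of [t0] are at most [e / 3 / C] apart, so an integrand bounded by [C]
   contributes at most [e / 3]. *)
pose d3 := e / 3 / C / 2.
have d30 : 0 < d3 by rewrite !divr_gt0.
exists (Num.min d1 (Num.min d2 d3)); first by rewrite !lt_min d10 d20.
move=> x hx xM t t' At At'; rewrite !lt_min => /and3P[t1 t2 t3] /and3P[t1' t2' t3'].
wlog tt : t t' At At' t1 t2 t3 t1' t2' t3' / t' <= t.
  move=> W; have [tt|/ltW tt] := leP t' t; first exact: W.
  by rewrite distrC; exact: W.
have It := rd_side_sub _ _ It0 sA _ At; have It' := rd_side_sub _ _ It0 sA _ At'.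
have hg := kernel_comp_rd _ _ It hx; have hg' := kernel_comp_rd _ _ It' hx.
set g := fun s => k t s (x s); set g' := fun s => k t' s (x s).
have J1 : `|delta_integral T a b g a t - delta_integral T a b g a t'| <= e / 3.
  apply: (le_trans (delta_integral_increment g C t' t hg _ It' It)).
    by move=> r Ir; apply: hC => //; exact: xM.
  rewrite mulrC -ler_pdivlMr// (splitr (e / 3 / C)) (le_trans (ler_distD t0 _ _))//.
  by rewrite lerD ?ltW// distrC.
have J2 : `|delta_integral T a b g a t' - delta_integral T a b g' a t'| <= e / 3.
  have /andP[at' tb'] := tsI_bounds _ It'.
  apply: (le_trans (delta_integral_dist g g' (e / 3 / (b - a)) a t' hg hg' _ tsI_left It' at')).
    by move=> r Ir; apply: h2 => //; rewrite ?xM// subrr normr0.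
  rewrite mulrAC ler_pdivrMr//; apply: ler_wpM2l; [exact: ltW|lra].
rewrite /volterra -/g -/g'.
rewrite (_ : f t + _ - _ = (f t - f t') +
  ((delta_integral T a b g a t - delta_integral T a b g a t') +
   (delta_integral T a b g a t' - delta_integral T a b g' a t'))); last by ring.
rewrite (le_trans (ler_normD _ _))// (_ : e = e / 3 + (e / 3 + e / 3)); last by field.
by rewrite lerD ?h1// (le_trans (ler_normD _ _))// lerD.
Qed.

Lemma volterra_rd x : rd_continuous T a b x -> rd_continuous T a b (V x).
Proof.
move=> hx; have [M M0 hM] := rd_bounded _ hx.
apply: rd_cauchy_continuous => t It A sA e e0.
have [d d0 hd] := volterra_equicontinuous _ _ M _ It sA e0.
by exists d => // s s'; exact: hd.
Qed.

(** Uniformly close arguments give integrands within [e / (b - a)]. In the application [x] is an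
    iterate and [y] the limit. *)
Lemma volterra_continuous t M e : I t -> 0 < e ->
  exists2 d : R, 0 < d & forall x y, rd_continuous T a b x -> rd_continuous T a b y ->
    (forall s, I s -> `|x s| <= M) -> (forall s, I s -> `|x s - y s| < d) ->
    `|V x t - V y t| <= e.
Proof.
move=> It e0; have [A sA At] := rd_side_mem _ It.
have ba : 0 < b - a by rewrite subr_gt0.
have eta0 : 0 < e / (b - a) by rewrite divr_gt0.
have [d d0 hd] := kernel_uniform _ _ M _ It sA eta0.
exists d => // x y hx hy xM xy.
have /andP[at' tb'] := tsI_bounds _ It.
rewrite /volterra opprD addrACA subrr add0r.
apply: (le_trans (delta_integral_dist _ _ (e / (b - a)) a t (kernel_comp_rd _ _ It hx)
  (kernel_comp_rd _ _ It hy) _ tsI_left It at')).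
  by move=> r Ir; apply: hd; rewrite ?subrr ?normr0 ?xM ?xy.
rewrite mulrAC ler_pdivrMr//; apply: ler_wpM2l; [exact: ltW|lra].
Qed.

Lemma volterra_mono x y t : rd_continuous T a b x -> rd_continuous T a b y ->
  (forall s, I s -> x s <= y s) -> I t -> V x t <= V y t.
Proof.
move=> hx hy xy It; rewrite /volterra lerD2l -[leRHS]addr0 -(mul0r (t - a)).
apply: delta_integral_le.
- exact: kernel_comp_rd.
- exact: kernel_comp_rd.
- by move=> r Ir; rewrite addr0 hkmono ?xy.
- exact: tsI_left.
- by [].
- by case/andP: (tsI_bounds _ It).
Qed.

(** * Limits of bounded, pointwise convergent iterations *)

Section Iteration.
Variables (M : R) (x_ : nat -> R -> R) (y : R -> R).
Hypotheses (x_rd : forall n, rd_continuous T a b (x_ n))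
  (x_rec : forall n, x_ n.+1 = V (x_ n))
  (x_bnd : forall n t, I t -> `|x_ n t| <= M)
  (x_cvg : forall t, I t -> x_ n t @[n --> \oo] --> y t).

Let x_near t e : I t -> 0 < e -> \forall n \near \oo, `|x_ n t - y t| <= e.
Proof.
move=> It e0; have /cvgrPdist_le/(_ e e0) := x_cvg t It.
by apply: filterS => n; rewrite distrC.
Qed.

(** The index is shifted because [x_ 0] need not be an image of [V]; for the later iterates the
    common bound [M] gives a common modulus. *)
Let x_equi t0 A e : I t0 -> rd_sides T a b t0 A -> 0 < e ->
  exists2 d : R, 0 < d & forall n t t', A t -> A t' ->
    `|t - t0| < d -> `|t' - t0| < d -> `|x_ n.+1 t - x_ n.+1 t'| <= e.
Proof.
move=> It sA e0; have [d d0 hd] := volterra_equicontinuous _ _ M _ It sA e0.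
by exists d => // n t t' At At' td td'; rewrite x_rec hd// => s; exact: x_bnd.
Qed.

Lemma iteration_limit_rd : rd_continuous T a b y.
Proof.
apply: rd_cauchy_continuous => t It A sA e e0.
have [d d0 hd] := x_equi _ _ _ It sA e0.
exists d => // s s' As As' sd sd'; apply/ler_addgt0Pr => c c0.
have c2 : 0 < c / 2 by rewrite divr_gt0.
have Is := rd_side_sub _ _ It sA _ As; have Is' := rd_side_sub _ _ It sA _ As'.
have [[|n] [// _ [h1 h2]]] := filter_ex (filterI (nbhs_infty_gt 0)
  (filterI (x_near _ _ Is c2) (x_near _ _ Is' c2))).
have := hd n s s' As As' sd sd'.
by move: h1 h2; rewrite !ler_norml => /andP[? ?] /andP[? ?] /andP[? ?]; lra.
Qed.

(* Monotone or not, a pointwise convergent iteration converges uniformly: the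
   iterates share a modulus of rd-continuity, as in the Arzela-Ascoli theorem. *)
Lemma iteration_uniform e : 0 < e ->
  \forall n \near \oo, forall t, I t -> `|x_ n t - y t| <= e.
Proof.
move=> e0; apply: rd_compact => t0 It0 A sA.
have e3 : 0 < e / 3 by rewrite divr_gt0.
have [d1 d10 h1] := x_equi _ _ _ It0 sA e3.
have [d2 d20 h2] := rd_continuous_cauchy _ iteration_limit_rd _ It0 _ sA _ e3.
exists (Num.min d1 d2); first by rewrite lt_min d10.
(* Pointwise convergence is used at [t1]; the moduli of the iterates and of the limit carry it to
   all nearby [t] in [A]. *)
have [[t1 [At1 t11 t12]]|no] :=
    pselect (exists t1, [/\ A t1, `|t1 - t0| < d1 & `|t1 - t0| < d2]); last first.
  near=> n => t At; rewrite lt_min => /andP[td1 td2].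
  by exfalso; apply: no; exists t.
have It1 := rd_side_sub _ _ It0 sA _ At1.
apply: filterS2 (nbhs_infty_gt 0) (x_near _ _ It1 e3) => -[//|n] _ h3 t At.
rewrite lt_min => /andP[td1 td2].
move: (h1 n t t1 At At1 td1 t11) (h2 t t1 At At1 td2 t12) h3.
by rewrite !ler_norml => /andP[? ?] /andP[? ?] /andP[? ?]; lra.
Unshelve. all: by end_near. Qed.

(** In [x_ n.+1 = V (x_ n)] the left side tends to [y t]; uniform convergence and continuity of [V]
    send the right side to [V y t]. *)
Lemma iteration_solution : solution T a b f k y.
Proof.
split=> [|t It]; first exact: iteration_limit_rd.
apply/eqP; rewrite -subr_eq0 -normr_le0; apply/ler_addgt0Pr => e e0; rewrite add0r.
have e2 : 0 < e / 2 by rewrite divr_gt0.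
have [d d0 hd] := volterra_continuous t M _ It e2.
have d20 : 0 < d / 2 by rewrite divr_gt0.
have [N _ hN] := iteration_uniform _ d20.
have [N' _ hN'] := x_near _ _ It e2.
pose n := maxn N N'.
have h1 : `|V (x_ n) t - V y t| <= e / 2.
  apply: hd => //; [exact: iteration_limit_rd|by move=> s; exact: x_bnd|move=> s Is].
  by have := hN n (leq_maxl _ _) s Is; lra.
have h2 : `|x_ n.+1 t - y t| <= e / 2.
  by apply: hN'; rewrite /= (leq_trans (leq_maxr N N')).
move: h1 h2; rewrite x_rec !ler_norml => /andP[? ?] /andP[? ?]; lra.
Qed.

Lemma iteration_cvg_uniform : {uniform I, x_ @ \oo --> y}.
Proof.
move=> P /uniform_nbhs[E []]; rewrite -entourage_ballE => -[e /= e0 he] hE.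
have e2 : 0 < e / 2 by rewrite divr_gt0.
have : \forall n \near \oo, P (x_ n); last by [].
apply: filterS (iteration_uniform _ e2) => n hn; apply: hE => t It; apply: he.
by rewrite /ball /= distrC; have := hn t It; lra.
Qed.

End Iteration.

(** * Monotonicity of the iterates *)

Local Notation iter_ := (iterates T a b f k).

Lemma iterates_rd x n : rd_continuous T a b x -> rd_continuous T a b (iter_ x n).
Proof. by move=> hx; elim: n => // n; exact: volterra_rd. Qed.

Lemma iterates_le x y n : rd_continuous T a b x -> rd_continuous T a b y ->
  (forall t, I t -> x t <= y t) -> forall t, I t -> iter_ x n t <= iter_ y n t.
Proof.
move=> hx hy xy; elim: n => // n IH t It.
by apply: volterra_mono => //; exact: iterates_rd.
Qed.

(** The iterate with index [n.+1] from [v] is the one with index [n] from [V v], and iteration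
    preserves [v <= V v]. *)
Lemma lower_iterates_nondecreasing v t : lower_solution T a b f k v -> I t ->
  nondecreasing_seq (fun n => iter_ v n t).
Proof.
move=> [hv vV] It; apply/nondecreasing_seqP => n.
have -> : iter_ v n.+1 = iter_ (V v) n by rewrite /iterates iterSr.
by apply: iterates_le => //; exact: volterra_rd.
Qed.

Lemma upper_iterates_nonincreasing w t : upper_solution T a b f k w -> I t ->
  nonincreasing_seq (fun n => iter_ w n t).
Proof.
move=> [hw wV] It; apply/nonincreasing_seqP => n.
have -> : iter_ w n.+1 = iter_ (V w) n by rewrite /iterates iterSr.
by apply: iterates_le => //; exact: volterra_rd.
Qed.

(** A solution agrees with its image under [V] only on the interval; monotonicity in both directions
    carries this agreement through the integral. *)
Lemma iterates_solution x n t : solution T a b f k x -> I t -> iter_ x n t = x t.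
Proof.
move=> [hx xE]; elim: n t => // n IH t It.
have hn := iterates_rd _ n hx.
rewrite [RHS]xE//; apply/eqP; rewrite eq_le; apply/andP; split.
  by apply: (volterra_mono (iter_ x n) x) => // s /IH ->.
by apply: (volterra_mono x (iter_ x n)) => // s /IH ->.
Qed.

End Kernel.
End TimeScale.

(** * Extremal solutions as limits of the two iterations *)

Theorem theorem1 (R : realType) (T : set R) (a b : R)
    (f : R -> R) (k : R -> R -> R -> R) (v w : R -> R)
    (hT : time_scale T) (ha : T a) (hb : T b) (hab : a < b)
    (hf : rd_continuous T a b f)
    (hk : rd_continuous3 T a b k)
    (hkmono : forall t s p q : R, tsI T a b t -> tsI T a b s -> p <= q ->
                k t s p <= k t s q)
    (hv : lower_solution T a b f k v)
    (hw : upper_solution T a b f k w)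
    (hvw : forall t, tsI T a b t -> v t <= w t) :
  let v_ := iterates T a b f k v in
  let w_ := iterates T a b f k w in
  exists beta alpha : R -> R,
    [/\ minimal_maximal_solutions T a b f k v w beta alpha,
        {uniform tsI T a b, v_ @ \oo --> beta},
        {uniform tsI T a b, w_ @ \oo --> alpha},
        forall t, tsI T a b t -> nondecreasing_seq (fun n => v_ n t) &
        forall t, tsI T a b t -> nonincreasing_seq (fun n => w_ n t)].
Proof.
move=> v_ w_; have [rv vV] := hv; have [rw wV] := hw.
have [Mv _ hMv] : exists2 M : R, 0 < M & forall t, tsI T a b t -> `|v t| <= M.
  exact: rd_bounded.
have [Mw _ hMw] : exists2 M : R, 0 < M & forall t, tsI T a b t -> `|w t| <= M.
  exact: rd_bounded.
have v_rd n : rd_continuous T a b (v_ n) by exact: iterates_rd.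
have w_rd n : rd_continuous T a b (w_ n) by exact: iterates_rd.
have v_incr t (It : tsI T a b t) : nondecreasing_seq (fun n => v_ n t).
  exact: lower_iterates_nondecreasing.
have w_decr t (It : tsI T a b t) : nonincreasing_seq (fun n => w_ n t).
  exact: upper_iterates_nonincreasing.
have vw n t (It : tsI T a b t) : v_ n t <= w_ n t by exact: iterates_le.
have bounds n t (It : tsI T a b t) :
    [/\ v t <= v_ n t, v_ n t <= w t, v t <= w_ n t & w_ n t <= w t].
  have v0 : v t <= v_ n t := v_incr t It 0 n (leq0n n).
  have w0 : w_ n t <= w t := w_decr t It 0 n (leq0n n).
  by split; rewrite ?(le_trans _ w0) ?(le_trans v0) ?vw.
have bnd z t : tsI T a b t -> v t <= z <= w t -> `|z| <= Mv + Mw.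
  move=> It /andP[vz zw]; have := hMv t It; have := hMw t It.
  by rewrite !ler_norml => /andP[? ?] /andP[? ?]; lra.
have v_bnd n t (It : tsI T a b t) : `|v_ n t| <= Mv + Mw.
  by apply: (bnd _ t) => //; have [-> ->] := bounds n t It.
have w_bnd n t (It : tsI T a b t) : `|w_ n t| <= Mv + Mw.
  by apply: (bnd _ t) => //; have [_ _ -> ->] := bounds n t It.
pose beta t := sup (range (fun n => v_ n t)).
pose alpha t := inf (range (fun n => w_ n t)).
have v_cvg t : tsI T a b t -> v_ n t @[n --> \oo] --> beta t.
  move=> It; apply: nondecreasing_cvgn; first exact: v_incr.
  by exists (w t) => _ [n _ <-]; have [] := bounds n t It.
have w_cvg t : tsI T a b t -> w_ n t @[n --> \oo] --> alpha t.
  move=> It; apply: nonincreasing_cvgn; first exact: w_decr.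
  by exists (v t) => _ [n _ <-]; have [] := bounds n t It.
exists beta, alpha; split=> //.
- split.
  + exact: (iteration_solution _ _ _ _ hT ha hb hab _ _ hf hk hkmono _ _ _ v_rd _ v_bnd v_cvg).
  + exact: (iteration_solution _ _ _ _ hT ha hb hab _ _ hf hk hkmono _ _ _ w_rd _ w_bnd w_cvg).
  + move=> x xs [rx vxw] t It.
    (* A solution in the sector is its own iterate, so [v <= x <= w] passes to [v_ n <= x <= w_ n],
       then to the supremum and the infimum. *)
    have xE n : iterates T a b f k x n t = x t by exact: iterates_solution.
    apply/andP; split.
      apply: ge_sup; first by exists (v_ 0 t), 0%N.
      move=> _ [n _ <-]; rewrite -(xE n).
      by apply: iterates_le => // s /vxw /andP[].
    apply: lb_le_inf; first by exists (w_ 0 t), 0%N.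
    move=> _ [n _ <-]; rewrite -(xE n).
    by apply: iterates_le => // s /vxw /andP[].
- exact: (iteration_cvg_uniform _ _ _ _ hT ha hb hab _ _ hf hk hkmono _ _ _ v_rd _ v_bnd v_cvg).
- exact: (iteration_cvg_uniform _ _ _ _ hT ha hb hab _ _ hf hk hkmono _ _ _ w_rd _ w_bnd w_cvg).
Qed.
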